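(* Let $\mathcal{H}$ be a real Hilbert space and let $A:\mathcal{H}\to 2^{\mathcal{H}}$ be maximally monotone with $\operatorname{zer}A\neq\varnothing$. Let $x_0\in\mathcal{H}$, let $(\lambda_k)_{k\in\mathbb{N}}$ be in $\left]0,2\right[$, $(\eta_k)_{k\in\mathbb{N}}$ in $\mathbb{R}_+$, $(c_k)_{k\in\mathbb{N}}$ in $\mathbb{R}_{++}$, $(e_k)_{k\in\mathbb{N}}$ in $\mathcal{H}$, and let $$(\forall k\in\mathbb{N})\quad x_{k+1}=(1-\lambda_k)x_k+\lambda_k \operatorname{J}_{c_kA}x_k+\eta_ke_k .$$ Let $\bar{x}\in\operatorname{zer}A$. Suppose that $A$ is metrically subregular at $\bar{x}$ for $0\in A\bar{x}$, i.e., there are $\kappa>0$ and $\delta>0$ (fixed from now on) such that $(\forall x\in B[\bar{x};\delta])$ $\operatorname{d}(x,A^{-1}0)\leq\kappa\operatorname{d}(0,Ax)$. Let $(\varepsilon_k)_{k\in\mathbb{N}}$ be in $\mathbb{R}_+$ such that $\eta_k\varepsilon_k\to0$. Suppose that $(\forall k\in\mathbb{N})$ $\|e_k\|\leq\varepsilon_k\|x_k-x_{k+1}\|$, that $\operatorname{J}_{c_kA}x_k\to\bar{x}$ (strongly), that $\liminf_{k\to\infty}c_k>0$, and that $0<\liminf_{k\to\infty}\lambda_k\leq\limsup_{k\to\infty}\lambda_k<2$. Set $$(\forall k\in\mathbb{N})\quad \rho_k:=\max\left\{\left(1-\frac{\lambda_k}{\frac{\kappa}{c_k}+1}\right)^2,\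 1-\lambda_k(2-\lambda_k)\frac{1}{1+\frac{\kappa^2}{c_k^2}}\right\}^{1/2}.$$ Then the following hold. (i) For every $k$ large enough, $\rho_k\in\left]0,1\right[$ and $$\|x_{k+1}-\operatorname{P}_{\operatorname{zer}A}(\operatorname{J}_{c_kA}x_k)\|\leq\frac{\rho_k+\eta_k\varepsilon_k}{1-\eta_k\varepsilon_k}\|x_k-\operatorname{P}_{\operatorname{zer}A}(\operatorname{J}_{c_kA}x_k)\|.$$ Moreover, there exist $\mu\in[0,1[$ and $K\in\mathbb{N}$ such that, for every $k\geq K$, $$\|x_{k+1}-\operatorname{P}_{\operatorname{zer}A}(\operatorname{J}_{c_kA}x_k)\|\leq\mu\|x_k-\operatorname{P}_{\operatorname{zer}A}(\operatorname{J}_{c_kA}x_k)\|\leq\mu^{k-K+1}\|x_K-\operatorname{P}_{\operatorname{zer}A}(\operatorname{J}_{c_KA}x_K)\|.$$ (ii) Suppose that $\operatorname{zer}A=\{\bar{x}\}$. Then for every $k$ large enough, $$\|x_{k+1}-\bar{x}\|\leq\frac{\rho_k+\eta_k\varepsilon_k}{1-\eta_k\varepsilon_k}\|x_k-\bar{x}\|.$$ Moreover, there exist $\mu\in[0,1[$ and $K\in\mathbb{N}$ such that $(\forall k\geq K)$ $\|x_{k+1}-\bar{x}\|\leq\mu\|x_k-\bar{x}\|\leq\mu^{k-K+1}\|x_K-\bar{x}\|$.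
   Context: $\mathbb{N}=\{0,1,2,\ldots\}$; $\mathbb{R}_+$ and $\mathbb{R}_{++}$ are the nonnegative and positive reals. $\operatorname{zer}A=A^{-1}0=\{x\in\mathcal{H}:0\in Ax\}$; for maximally monotone $A$ it is closed and convex, and $\operatorname{P}_{\operatorname{zer}A}$ is the projector onto it. The resolvent is $\operatorname{J}_{\gamma A}=(\operatorname{Id}+\gamma A)^{-1}$, which for maximally monotone $A$ and $\gamma>0$ is single-valued with full domain. $B[\bar{x};r]$ is the closed ball of center $\bar{x}$ and radius $r$. $\operatorname{d}(x,C)=\inf_{y\in C}\|x-y\|$, with $\inf\varnothing=+\infty$. *)

(* Defs.v *)
From HB Require Import structures.
From mathcomp Require Import all_boot all_order all_algebra.
From mathcomp Require Import all_classical all_reals all_analysis.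
Import Order.TTheory GRing.Theory Num.Theory.
Import numFieldNormedType.Exports.

Set Implicit Arguments.
Unset Strict Implicit.
Unset Printing Implicit Defensive.

Local Open Scope classical_set_scope.
Local Open Scope ring_scope.

(** A real Hilbert space is a [completeNormedModType R] [H] together with a
    positive definite symmetric bilinear form [ip : {dot H for idfun}] that
    induces its norm: *)
Definition induces_norm (R : realType) (H : normedModType R)
    (ip : {dot H for idfun}) : Prop :=
  forall x : H, `|x| ^+ 2 = ip x x.

(** A set-valued operator [A : H -> 2^H] is a function [H -> set H]. *)
Section Operators.
Variables (R : realType) (H : normedModType R).
Implicit Types (A : H -> set H) (C : set H) (x u : H).

Definition op_inv A : H -> set H := fun u => [set x | A x u].

Definition zer A : set H := op_inv A 0.

Definition monotone_op (ip : {dot H for idfun}) A : Prop :=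
  forall x y u v, A x u -> A y v -> 0 <= ip (x - y) (u - v).

Definition maximally_monotone (ip : {dot H for idfun}) A : Prop :=
  monotone_op ip A /\
  forall B : H -> set H, monotone_op ip B ->
    (forall x, A x `<=` B x) -> forall x, B x `<=` A x.

Definition id_plus (gamma : R) A : H -> set H :=
  fun x => [set x + gamma *: u | u in A x].

(** [resolvent gamma A x] is the element of [(Id + gamma A)^-1 x]; the default
    value [0] is returned only if this set is empty, which does not happen when
    [A] is maximally monotone and [0 < gamma]. *)
Definition resolvent (gamma : R) A : H -> H :=
  fun x => xget 0 (op_inv (id_plus gamma A) x).

(** The distance is valued in [\bar R], so that [edistance x set0 = +oo]. *)
Definition edistance x C : \bar R := ereal_inf [set `|x - y|%:E | y in C].

(** A nearest point of [C] to [x]; it exists and is unique when [C] is a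
    nonempty closed convex subset of a Hilbert space. *)
Definition projector C : H -> H :=
  fun x => xget 0 [set p | C p /\ `|x - p|%:E = edistance x C].

(** [A] is metrically subregular at [xbar] for [u \in A xbar], with constant
    [kappa] on the closed ball of radius [delta]. *)
Definition metrically_subregular A xbar u (kappa delta : R) : Prop :=
  [/\ A xbar u, 0 < kappa, 0 < delta &
    forall x, closed_ball xbar delta x ->
      (edistance x (op_inv A u) <= kappa%:E * edistance u (A x))%E].

End Operators.

Definition rho (R : realType) (kappa c lambda : R) : R :=
  Num.sqrt (Num.max
    ((1 - lambda / (kappa / c + 1)) ^+ 2)
    (1 - lambda * (2 - lambda) * (1 / (1 + kappa ^+ 2 / c ^+ 2)))).

(* Main.v *)
(** Write [J] for [J_{c_k A} x_k], [a = J - p] and [b = x_k - J] with [p] a zero of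
    [A]. Monotonicity gives [0 <= <a, b>], and for [p = P J] metric subregularity
    gives [|a| <= (kappa / c_k) |b|]; these two facts imply
    [|a + (1 - lambda_k) b| <= rho_k |a + b|], and the error term costs only the
    factor in [eta_k eps_k].

    Since [q_(k+1)] need not be [q_k] (nor the projection of [x_(k+1)]), this
    one-step estimate does not iterate. The distance of [x_k] to [zer A] does
    decrease geometrically, by the same facts applied to [p = P x_k], and
    [|x_k - q_k|] is at most twice that distance. Hence [|x_k - q_k|] is
    [O(mu1 ^ k)] for some [mu1 < 1], and taking [mu] strictly between [mu1] and [1]
    one can start at the index [K] that maximises [|x_k - q_k| / mu ^ k].

    Resolvents have full domain by Minty's theorem, obtained by minimising the
    Fitzpatrick function plus half the squared norm on [H * H]. *)
Require Import Defs.
From mathcomp Require Import all_boot all_order all_algebra.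
From mathcomp Require Import all_classical all_reals all_analysis.
From mathcomp Require Import zify ring lra.
Import Order.TTheory GRing.Theory Num.Theory.
Import numFieldNormedType.Exports.

Local Open Scope classical_set_scope.
Local Open Scope ring_scope.

(** * Hilbert space preliminaries: Cauchy sequences, inner product, minimisation *)

Lemma cvgn_sqr_dist_le (R : realType) (V : completeNormedModType R)
    (u : nat -> V) (b : nat -> R) :
  b @ \oo --> (0 : R) ->
  (forall n m, `|u n - u m| ^+ 2 <= b n + b m) -> cvgn u.
Proof.
move=> b0 ub; apply: cauchy_cvg; apply: cauchy_exP => r r0.
have r20 : 0 < r ^+ 2 / 2 by rewrite divr_gt0 ?exprn_gt0.
have [N _ bN] : \forall n \near \oo, b n < r ^+ 2 / 2 by exact: cvgr_lt b0 _ r20.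
exists (u N); exists N => // n Nn /=.
rewrite -ball_normE /= -(ltr_pXn2r (n := 2)) ?nnegrE ?(ltW r0)//.
rewrite (le_lt_trans (ub _ _))// [ltRHS]splitr.
by apply: ltrD; apply: bN => /=.
Qed.

Section InnerProduct.
Context {R : realType} {H : normedModType R} {ip : {dot H for idfun}}.
Implicit Types (x y z : H) (a : R).

Lemma ipC x y : ip x y = ip y x.
Proof. by rewrite hermC /= expr0 mul1r. Qed.

Lemma ipDl z x y : ip (x + y) z = ip x z + ip y z.
Proof. exact: linearDl. Qed.

Lemma ipDr z x y : ip z (x + y) = ip z x + ip z y.
Proof. exact: linearDr. Qed.

Lemma ipBl z x y : ip (x - y) z = ip x z - ip y z.
Proof. exact: linearBl. Qed.

Lemma ipBr z x y : ip z (x - y) = ip z x - ip z y.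
Proof. exact: linearBr. Qed.

Lemma ipNl z x : ip (- x) z = - ip x z.
Proof. exact: linearNl. Qed.

Lemma ipNr z x : ip z (- x) = - ip z x.
Proof. exact: linearNr. Qed.

Lemma ipZl z a x : ip (a *: x) z = a * ip x z.
Proof. exact: linearZl_LR. Qed.

Lemma ipZr z a x : ip z (a *: x) = a * ip z x.
Proof. exact: linearZr_LR. Qed.

Definition ipE := (ipDl, ipDr, ipBl, ipBr, ipNl, ipNr, ipZl, ipZr).

Context (ipH : induces_norm ip).

Lemma ip_cauchy_schwarz x y : ip x y <= `|x| * `|y|.
Proof.
have : `|x + y| ^+ 2 <= (`|x| + `|y|) ^+ 2.
  by rewrite lerXn2r ?nnegrE ?addr_ge0// ler_normD.
rewrite ipH !ipE (ipC y x) sqrrD !ipH; lra.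
Qed.

Lemma normD_sqr x y : `|x + y| ^+ 2 = `|x| ^+ 2 + 2 * ip x y + `|y| ^+ 2.
Proof. by rewrite !ipH !ipE (ipC y x); ring. Qed.

(** Parallelogram identity; its term in [x - y] is what makes minimising sequences Cauchy. *)
Lemma norm_midpoint_sqr x y :
  `|2^-1 *: (x + y)| ^+ 2
  = (`|x| ^+ 2 + `|y| ^+ 2) / 2 - `|x - y| ^+ 2 / 4.
Proof. by rewrite !ipH !ipE (ipC y x); field. Qed.

Lemma cvg_ip (T : Type) (F : set_system T) {FF : Filter F} (u v : T -> H) x y :
  u @ F --> x -> v @ F --> y -> (fun t => ip (u t) (v t)) @ F --> ip x y.
Proof.
(* Polarisation reduces the continuity of [ip] to that of the norm. *)
have ipP (a b : H) : ip a b = 2^-1 * (`|a + b| ^+ 2 - `|a| ^+ 2 - `|b| ^+ 2).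
  by rewrite normD_sqr; field.
move=> ux vy; rewrite ipP; under eq_fun do rewrite ipP.
have sqr_cvg (w : T -> H) (z : H) : w @ F --> z ->
    (fun t => `|w t| ^+ 2) @ F --> `|z| ^+ 2.
  move=> wz; rewrite expr2; under eq_fun do rewrite expr2.
  by apply: cvgM; exact: cvg_norm.
apply: cvgM; first exact: cvg_cst.
by apply: cvgB; [apply: cvgB|]; apply: sqr_cvg => //; exact: cvgD.
Qed.

End InnerProduct.

(* The two [H]-components make the lemma usable on the product space [H * H]
   with its Hilbert norm (MathComp-Analysis puts the max norm on products). *)
Lemma strongly_convex_minimizer (R : realType) (H : completeNormedModType R)
    (ip : {dot H for idfun}) (ipH : induces_norm ip)
    (G : H -> H -> R -> Prop) (m0 : R) :
  (exists x u t, G x u t) ->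
  (forall x u t, G x u t -> m0 <= t + `|x| ^+ 2 + `|u| ^+ 2) ->
  (forall x u t x' u' t', G x u t -> G x' u' t' ->
     G (2^-1 *: (x + x')) (2^-1 *: (u + u')) (2^-1 * (t + t'))) ->
  (forall (X U : nat -> H) (T : nat -> R) x u t, (forall n, G (X n) (U n) (T n)) ->
     X @ \oo --> x -> U @ \oo --> u -> T @ \oo --> t -> G x u t) ->
  exists x u t, G x u t /\ forall x' u' t', G x' u' t' ->
    t + `|x| ^+ 2 + `|u| ^+ 2 <= t' + `|x'| ^+ 2 + `|u'| ^+ 2.
Proof.
move=> [x0 [u0 [t0 G0]]] Gm0 Gmid Gcl.
(* [G] is read as the epigraph of a midpoint-convex function, [t] bounding its value at [(x, u)]. *)
pose f (p : H * H * R) := p.2 + `|p.1.1| ^+ 2 + `|p.1.2| ^+ 2.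
pose S := [set f p | p in [set p | G p.1.1 p.1.2 p.2]].
have infS : has_inf S.
  split; first by exists (f (x0, u0, t0)), (x0, u0, t0).
  by exists m0 => _ [[[x u] t] /= Gp <-]; exact: Gm0.
have mle x u t : G x u t -> inf S <= t + `|x| ^+ 2 + `|u| ^+ 2.
  by move=> Gp; apply: inf_lbound; [case: infS | exists (x, u, t)].
have [p pP] : {p : nat -> H * H * R & forall n,
    G (p n).1.1 (p n).1.2 (p n).2 /\ f (p n) < inf S + n.+1%:R^-1}.
  apply: (@choice _ _ (fun n q => G q.1.1 q.1.2 q.2 /\ f q < inf S + n.+1%:R^-1)).
  move=> n; have n0 : 0 < n.+1%:R^-1 :> R by [].
  by have [_ [q Gq <-] fq] := inf_adherent n0 infS; exists q.
have h0 : (fun n => 2 * n.+1%:R^-1 : R) @ \oo --> (0 : R).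
  rewrite -[X in _ --> X](mulr0 2); apply: cvgM; first exact: cvg_cst.
  exact: cvg_harmonic.
(* The midpoint has value at least [inf S], so the parallelogram identity turns the excess of [f]
   over [inf S] into a bound on distances. *)
have dist n k : `|(p n).1.1 - (p k).1.1| ^+ 2 + `|(p n).1.2 - (p k).1.2| ^+ 2
    <= 2 * n.+1%:R^-1 + 2 * k.+1%:R^-1.
  have [Gn fn] := pP n; have [Gk fk] := pP k.
  have := mle _ _ _ (Gmid _ _ _ _ _ _ Gn Gk).
  rewrite !(norm_midpoint_sqr ipH); rewrite /f in fn fk.
  move: (n.+1%:R^-1) (k.+1%:R^-1) fn fk => hn hk; lra.
have Xc : cvgn (fun n => (p n).1.1).
  apply: (cvgn_sqr_dist_le _ _ _ _ h0) => n k; apply: le_trans (dist n k).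
  by rewrite lerDl exprn_ge0.
have Uc : cvgn (fun n => (p n).1.2).
  apply: (cvgn_sqr_dist_le _ _ _ _ h0) => n k; apply: le_trans (dist n k).
  by rewrite lerDr exprn_ge0.
set x := limn (fun n => (p n).1.1) in Xc; set u := limn (fun n => (p n).1.2) in Uc.
have fc : (fun n => f (p n)) @ \oo --> inf S.
  apply: (@squeeze_cvgr _ _ _ _ (fun=> inf S) (fun n => inf S + n.+1%:R^-1)).
  - near=> n; have [Gn fn] := pP n.
    by rewrite (mle _ _ _ Gn) (ltW fn).
  - exact: cvg_cst.
  - rewrite -[X in _ --> X]addr0; apply: cvgD; first exact: cvg_cst.
    exact: cvg_harmonic.
exists x, u, (inf S - `|x| ^+ 2 - `|u| ^+ 2); split; last first.
  by move=> x' u' t' /mle; congr (_ <= _); ring.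
apply: (Gcl (fun n => (p n).1.1) (fun n => (p n).1.2) (fun n => (p n).2)) => //.
- by move=> n; case: (pP n).
(* Convergence of the [t] components is inferred from that of [f] and of the other two
   components. *)
have -> : (fun n => (p n).2) = (fun n => f (p n) - `|(p n).1.1| ^+ 2 - `|(p n).1.2| ^+ 2).
  by apply/funext => n; rewrite /f; ring.
rewrite (ipH x) (ipH u); under eq_fun do rewrite (ipH (p _).1.1) (ipH (p _).1.2).
apply: cvgB; last exact: (cvg_ip ipH).
by apply: cvgB => //; exact: (cvg_ip ipH).
Unshelve. all: by end_near. Qed.

(** * Maximal monotonicity, Minty's theorem and the resolvent *)

(** Adjoining [(x, u)] to the graph of [A] keeps it monotone. *)
Lemma maximally_monotone_mem (R : realType) (H : normedModType R)
    (ip : {dot H for idfun}) (A : H -> set H) (maxA : maximally_monotone ip A) x u :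
  (forall a b, A a b -> 0 <= ip (x - a) (u - b)) -> A x u.
Proof.
move=> rel; have [monA /(_ (fun y => A y `|` [set v | y = x /\ v = u]))] := maxA.
apply; [|by move=> y v; left|by right].
move=> y z v w [Ayv|[-> ->]] [Azw|[-> ->]]; first exact: monA.
- by rewrite -(opprB x) -(opprB u) ipNl ipNr opprK; exact: rel.
- exact: rel.
- by rewrite !subrr linear0l.
Qed.

(* If [(x, u)] minimises the Fitzpatrick function of [A] plus half the squared
   norm, then [(-u, -x)] is monotonically related to [A], hence in its graph;
   testing optimality against this point forces [x = -u]. *)
Lemma minty_zero (R : realType) (H : completeNormedModType R)
    (ip : {dot H for idfun}) (ipH : induces_norm ip) (A : H -> set H) :
  monotone_op ip A ->
  (forall x u, (forall a b, A a b -> 0 <= ip (x - a) (u - b)) -> A x u) ->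
  exists x, A x (- x).
Proof.
move=> monA relA.
(* Epigraph of twice the Fitzpatrick function; the doubling turns half the squared norm into the
   whole one. *)
pose G x u (t : R) := forall a b, A a b -> 2 * (ip x b + ip a u - ip a b) <= t.
have GA a b : A a b -> G a b (2 * ip a b).
  move=> Aab a' b' /(monA _ _ _ _ Aab); rewrite !ipE; lra.
(* The Fitzpatrick function dominates [ip x u]: otherwise [(x, u)] is monotonically related to [A],
   hence in its graph, and [Gxut] fails at that very point. *)
have Gip x u t : G x u t -> 2 * ip x u <= t.
  move=> Gxut; rewrite leNgt; apply/negP => tlt.
  suff /Gxut : A x u by lra.
  by apply: relA => a b /Gxut; rewrite !ipE; lra.
have [||||x [u [t [Gxut min]]]] := @strongly_convex_minimizer _ _ ip ipH G 0.
- have [[a [b /GA ?]]|A0] := pselect (exists a b, A a b); first by do 3 eexists; eauto.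
  exists 0, 0, (2 * ip 0 0); apply/GA/relA => a b Aab.
  by case: A0; exists a, b.
- move=> x u t /Gip tge.
  have := exprn_ge0 2 (normr_ge0 (x + u)); rewrite (normD_sqr ipH); lra.
- move=> x u t x' u' t' Gx Gx' a b Aab.
  by have := Gx _ _ Aab; have := Gx' _ _ Aab; rewrite !ipE; lra.
- move=> X U T x u t GX Xx Uu Tt a b Aab.
  apply: (ler_cvg_to (f := fun n => 2 * (ip (X n) b + ip a (U n) - ip a b)) _ Tt).
  + apply: cvgM; first exact: cvg_cst.
    by apply: cvgB; [apply: cvgD; apply: (cvg_ip ipH) => //|]; exact: cvg_cst.
  + by near=> n; exact: GX.
have opt a b : A a b -> `|x + u| ^+ 2 <= ip (a + u) (b + x).
  move=> Aab; have Gab := GA _ _ Aab.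
  pose B := 2 * ip a b - t + 2 * ip x (a - x) + 2 * ip u (b - u).
  pose C := `|a - x| ^+ 2 + `|b - u| ^+ 2.
  (* Minimality along the segment from [(x, u)] to [(a, b)], divided by [l]; small [l] then forces
     [0 <= B]. *)
  have quad l : 0 < l < 1 -> 0 <= B + l * C.
    move=> /andP[l0 l1].
    have := min (x + l *: (a - x)) (u + l *: (b - u)) (t + l * (2 * ip a b - t)).
    have GI : G (x + l *: (a - x)) (u + l *: (b - u)) (t + l * (2 * ip a b - t)).
      have l1' : 0 <= 1 - l by lra.
      move=> a' b' Aab'.
      have := ler_wpM2l l1' (Gxut _ _ Aab').
      have := ler_wpM2l (ltW l0) (Gab _ _ Aab').
      rewrite !ipE; lra.
    move=> /(_ GI); rewrite !(normD_sqr ipH) !normrZ !exprMn !ipZr real_normK ?num_real//.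
    move=> h; suff : 0 <= l * (B + l * C) by rewrite pmulr_rge0.
    by move: h; rewrite /B /C; lra.
  have B0 : 0 <= B.
    rewrite leNgt; apply/negP => Blt.
    have C0 : 0 <= C by rewrite addr_ge0 ?exprn_ge0.
    have D0 : 0 < 1 + C - B by lra.
    (* An explicit [l] at which [B + l * C] would still be negative. *)
    have /quad : 0 < - B / (1 + C - B) < 1.
      by rewrite divr_gt0 ?oppr_gt0//= ltr_pdivrMr//; lra.
    have -> : B + - B / (1 + C - B) * C = B * (1 - B) / (1 + C - B).
      by field; rewrite gt_eqF.
    by rewrite leNgt pmulr_llt0 ?invr_gt0// nmulr_rlt0//; lra.
  have := Gip _ _ _ Gxut; move: B0.
  rewrite (normD_sqr ipH) /B !ipE !ipH (ipC a x) (ipC u x); lra.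
have Aux : A (- u) (- x).
  apply: relA => a b /opt; rewrite !ipE => h.
  by have := exprn_ge0 2 (normr_ge0 (x + u)); lra.
have := opt _ _ Aux; rewrite addNr linear0l => xu0.
have /eqP : `|x + u| ^+ 2 = 0 by apply/eqP; rewrite eq_le xu0 exprn_ge0.
rewrite sqrf_eq0 normr_eq0 addr_eq0 => /eqP xE.
by exists x; rewrite {1}xE.
Unshelve. all: by end_near. Qed.

Lemma resolventP (R : realType) (H : completeNormedModType R)
    (ip : {dot H for idfun}) (ipH : induces_norm ip) (A : H -> set H)
    (maxA : maximally_monotone ip A) (gamma : R) (gamma_gt0 : 0 < gamma) z :
  A (resolvent gamma A z) (gamma^-1 *: (z - resolvent gamma A z)).
Proof.
have g0 : gamma != 0 by rewrite gt_eqF.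
(* A point [y] with [- y] in [A' y] is one for which [z] lies in [y + gamma A y]. *)
pose A' x := [set gamma *: v - z | v in A x].
have [||y [v Ayv vE]] := @minty_zero _ _ ip ipH A'.
- move=> x y _ _ [u Axu <-] [v Ayv <-].
  rewrite opprB addrA subrK -scalerBr ipZr pmulr_rge0//.
  by case: maxA => monA _; exact: monA.
- move=> x u rel; exists (gamma^-1 *: (u + z)); last by rewrite scalerA divff// scale1r addrK.
  apply: (maximally_monotone_mem _ _ _ _ maxA) => a b Aab.
  have /rel : A' a (gamma *: b - z) by exists b.
  rewrite -(pmulr_rge0 _ gamma_gt0) -ipZr scalerBr scalerA divff// scale1r.
  by rewrite opprB addrA (addrAC u).
have : op_inv (id_plus gamma A) z (resolvent gamma A z).
  apply: xgetPex; exists y; exists v => //.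
  by apply/eqP; rewrite addrC -subr_eq0 -addrA (addrC y) addrA vE addNr.
move=> [w Aw wE]; rewrite -{2}wE addrAC subrr add0r scalerA mulVf// scale1r.
exact: Aw.
Qed.

(** * Projections, and the geometry of the set of zeros *)

Lemma projectorP (R : realType) (H : completeNormedModType R)
    (ip : {dot H for idfun}) (ipH : induces_norm ip) (C : set H) (x : H) :
  C !=set0 -> closed C ->
  (forall y z, C y -> C z -> C (2^-1 *: (y + z))) ->
  C (projector C x) /\ `|x - projector C x|%:E = edistance x C.
Proof.
move=> [y0 Cy0] Ccl Cmid.
(* The minimised variable is the difference between [x] and a point of [C]; the other two components
   are frozen at [0]. *)
pose G (y u : H) (t : R) := [/\ C (x - y), u = 0 & t = 0].
have [||||y [u [t [[Cy u0 t0] min]]]] := @strongly_convex_minimizer _ _ ip ipH G 0.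
- by exists (x - y0), 0, 0; split; rewrite // opprB addrC subrK.
- by move=> y u t [_ -> ->]; rewrite normr0 expr0n/= addr0 add0r exprn_ge0.
- move=> y u t y' u' t' [Cy -> ->] [Cy' -> ->]; split; rewrite ?addr0 ?scaler0 ?mulr0//.
  have -> : x - 2^-1 *: (y + y') = 2^-1 *: ((x - y) + (x - y')).
    rewrite addrACA -opprD scalerBr -mulr2n -(scaler_nat 2 x) scalerA mulVf ?scale1r//.
  exact: Cmid.
- move=> X U T y u t GX Xy Uu Tt; split.
  + apply: (closed_cvg (u_ := fun n => x - X n) (F := \oo) C Ccl).
      by near=> n; case: (GX n).
    by apply: cvgB => //; exact: cvg_cst.
  + have U0 : U = cst 0 by apply/funext => n; case: (GX n).
    by move: Uu; rewrite U0 => /(norm_cvg_unique (cvg_cst _)).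
  + have T0 : T = cst 0 by apply/funext => n; case: (GX n).
    by move: Tt; rewrite T0 => /(norm_cvg_unique (cvg_cst _)).
suff : exists p, C p /\ `|x - p|%:E = edistance x C by exact: (@xgetPex _ 0).
exists (x - y); split=> //; apply/eqP; rewrite eq_le; apply/andP; split.
  apply: le_ereal_inf_tmp => _ [z Cz <-]; rewrite lee_fin opprB addrC subrK.
  have /min : G (x - z) 0 0 by split; rewrite // opprB addrC subrK.
  by rewrite u0 t0 normr0 expr0n/= !addr0 !add0r ler_sqr ?nnegrE.
by apply: ge_ereal_inf; exists (`|x - (x - y)|%:E) => //; exists (x - y).
Unshelve. all: by end_near. Qed.

Lemma projector_le (R : realType) (H : normedModType R) (C : set H) (x y : H) :
  `|x - projector C x|%:E = edistance x C -> C y ->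
  `|x - projector C x| <= `|x - y|.
Proof.
by move=> E Cy; rewrite -lee_fin E; apply: ge_ereal_inf; exists `|x - y|%:E => //; exists y.
Qed.

Section Zeros.
Context {R : realType} {H : normedModType R} {ip : {dot H for idfun}}.
Context (ipH : induces_norm ip) {A : H -> set H} (maxA : maximally_monotone ip A).

(** By maximality, [z] is a zero iff [(z, 0)] is monotonically related to the graph. Closedness and
    stability under midpoints are read off these half-spaces. *)
Lemma zerE :
  zer A = \bigcap_(p in [set p : H * H | A p.1 p.2])
            [set z | 0 <= ip (z - p.1) (- p.2)].
Proof.
have [monA _] := maxA; apply/seteqP; split => z.
  by move=> Az [a b] /= Aab; rewrite -[- b]add0r; exact: monA.
move=> h; apply: (maximally_monotone_mem _ _ _ _ maxA) => a b Aab.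
by rewrite add0r; exact: (h (a, b)).
Qed.

Lemma closed_zer : closed (zer A).
Proof.
rewrite zerE; apply: closed_bigI => -[a b] _ /=.
apply: (@closed_comp _ _ (fun z => ip (z - a) (- b)) [set r : R | 0 <= r]).
  move=> z _; apply: (cvg_ip ipH); last exact: cvg_cst.
  by apply: cvgB; [exact: cvg_id | exact: cvg_cst].
exact: closed_ge.
Qed.

Lemma midpoint_zer y z : zer A y -> zer A z -> zer A (2^-1 *: (y + z)).
Proof.
rewrite zerE => Zy Zz p Ap; have := Zy p Ap; have := Zz p Ap.
by rewrite /= !ipE; lra.
Qed.

End Zeros.

(** * Contraction factors of a relaxed step *)

Section Relaxation.
Context {R : realType} {H : normedModType R} {ip : {dot H for idfun}}.
Context (ipH : induces_norm ip).
Implicit Types (a b : H) (lam s : R).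

(** The two sides differ by exactly [2 * lam * ip a b]. *)
Lemma relaxation_le a b lam : 0 < lam -> 0 <= ip a b ->
  `|a + (1 - lam) *: b| ^+ 2 <= `|a + b| ^+ 2 - lam * (2 - lam) * `|b| ^+ 2.
Proof.
move=> l0 ab0; have := mulr_ge0 (ltW l0) ab0.
rewrite !(normD_sqr ipH) normrZ exprMn real_normK ?num_real// ipZr; lra.
Qed.

(* Both sides are affine in [ip a b], which ranges over [0, |a| |b|]: it is
   enough to compare them at the two endpoints. *)
Lemma relaxation_contraction a b lam kappa c :
  0 < lam < 2 -> 0 < kappa -> 0 < c ->
  0 <= ip a b -> `|a| <= kappa / c * `|b| ->
  `|a + (1 - lam) *: b| <= rho kappa c lam * `|a + b|.
Proof.
move=> /andP[l0 l2] k0 c0 ab0; rewrite /rho -expr_div_n.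
have s0 : 0 < kappa / c by rewrite divr_gt0.
move: (kappa / c) s0 => s s0 {kappa c k0 c0} als.
set M := Num.max _ _.
have M1 : (1 - lam / (s + 1)) ^+ 2 <= M by rewrite /M le_max lexx.
have M2 : 1 - lam * (2 - lam) * (1 / (1 + s ^+ 2)) <= M by rewrite /M le_max lexx orbT.
have M0 : 0 <= M by rewrite (le_trans _ M1)// sqr_ge0.
have ll : 0 <= lam * (2 - lam) by rewrite mulr_ge0// ?subr_ge0 ltW.
have s1 : 0 < 1 + s ^+ 2 by rewrite ltr_wpDr ?exprn_ge0 ?ltW.
have s1' : 0 < s + 1 by rewrite addr_gt0.
(* A third lower bound on [M], for the case where [al + (1 - lam) * be] is negative. *)
have M3 : (1 - lam) ^+ 2 <= M.
  apply: le_trans M2; rewrite div1r.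
  have : (1 + s ^+ 2)^-1 <= 1 by rewrite invf_le1// lerDl exprn_ge0// ltW.
  move=> /(ler_wpM2l ll); lra.
suff : `|a + (1 - lam) *: b| ^+ 2 <= (Num.sqrt M * `|a + b|) ^+ 2.
  by rewrite ler_sqr ?nnegrE ?mulr_ge0 ?sqrtr_ge0.
rewrite exprMn sqr_sqrtr// !(normD_sqr ipH) normrZ exprMn real_normK ?num_real// ipZr.
have := ip_cauchy_schwarz ipH a b; have := normr_ge0 a; have := normr_ge0 b.
move: (ip a b) `|a| `|b| ab0 als => g al be g0 als be0 al0 gle.
have al2 : al ^+ 2 <= s ^+ 2 * be ^+ 2.
  by rewrite -exprMn ler_sqr ?nnegrE// mulr_ge0// ltW.
have end0 : al ^+ 2 + (1 - lam) ^+ 2 * be ^+ 2 <= M * (al ^+ 2 + be ^+ 2).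
  have := ler_wpM2r (addr_ge0 (sqr_ge0 al) (sqr_ge0 be)) M2.
  have : 1 / (1 + s ^+ 2) * (al ^+ 2 + be ^+ 2) <= be ^+ 2.
    by rewrite div1r mulrC ler_pdivrMr//; lra.
  move=> /(ler_wpM2l ll); lra.
have end1 : (al + (1 - lam) * be) ^+ 2 <= M * (al + be) ^+ 2.
  have h1 : al + (1 - lam) * be <= (1 - lam / (s + 1)) * (al + be).
    have : (al + be) / (s + 1) <= be by rewrite ler_pdivrMr//; lra.
    move=> /(ler_wpM2l (ltW l0)); lra.
  have [v0|v0] := leP 0 (al + (1 - lam) * be).
    apply: le_trans (ler_wpM2r (sqr_ge0 _) M1); rewrite -exprMn.
    by rewrite ler_sqr ?nnegrE// (le_trans v0).
  apply: le_trans (ler_wpM2r (sqr_ge0 _) M3); rewrite -exprMn.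
  rewrite -sqrrN -[leRHS]sqrrN ler_sqr ?nnegrE ?oppr_ge0 ?(ltW v0)// ?lerN2.
    by have := mulr_ge0 (ltW l0) al0; lra.
  by have := mulr_ge0 (ltW l0) al0; lra.
(* The gap between the two sides has slope [2 * (M - 1 + lam)] in [g]; its sign decides which
   endpoint, [g = 0] or [g = al * be], is the worst. *)
have [h|h] := leP 0 (M - 1 + lam).
  by have := mulr_ge0 h g0; lra.
have := ler_wnM2l (ltW h) gle; lra.
Qed.

End Relaxation.

(** Since [lam * (2 - lam) <= 1], the second term of the maximum is positive. *)
Lemma rho_gt0 (R : realType) (kappa c lam : R) :
  0 < kappa -> 0 < c -> 0 < lam < 2 -> 0 < rho kappa c lam.
Proof.
move=> k0 c0 /andP[l0 l2]; rewrite sqrtr_gt0 lt_max -expr_div_n; apply/orP; right.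
have s0 : 0 < (kappa / c) ^+ 2 by rewrite exprn_gt0// divr_gt0.
rewrite div1r subr_gt0 ltr_pdivrMr ?addr_gt0// mul1r.
by have := sqr_ge0 (lam - 1); lra.
Qed.

Lemma rho_uniform_lt1 (R : realType) (kappa c0 l0 l1 : R) :
  0 < kappa -> 0 < c0 -> 0 < l0 -> l1 < 2 ->
  exists2 r, r < 1 & forall c lam, c0 <= c -> l0 <= lam -> lam <= l1 ->
    rho kappa c lam <= r.
Proof.
move=> k0 c00 l00 l12; pose s0 := kappa / c0.
have s00 : 0 < s0 by rewrite divr_gt0.
have [l01|l10] := leP l0 l1; last first.
  exists 0 => // c lam _ h1 h2.
  by have := lt_le_trans l10 (le_trans h1 h2); rewrite ltxx.
(* The base [1 - lam / (s + 1)] of the square may be negative; its opposite is then at most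
   [lam - 1], hence at most [l1 - 1]. *)
pose a := Num.max (1 - l0 / (s0 + 1)) (l1 - 1).
pose b := 1 - l0 * (2 - l1) / (1 + s0 ^+ 2).
have s1 : 0 < s0 + 1 by rewrite addr_gt0.
have s2 : 0 < 1 + s0 ^+ 2 by rewrite addr_gt0// exprn_gt0.
have ll : 0 < l0 * (2 - l1) by rewrite mulr_gt0// subr_gt0.
have a0 : 0 <= a.
  have [h|h] := leP 1 l1; rewrite le_max; apply/orP; [right|left]; rewrite subr_ge0//.
  by rewrite ler_pdivrMr//; lra.
have a1 : a < 1 by rewrite gt_max ltrBlDr ltrDl divr_gt0//=; lra.
exists (Num.sqrt (Num.max (a ^+ 2) b)).
  rewrite -sqrtr1 ltr_sqrt// gt_max expr_lt1// a1/= ltrBlDr ltrDl divr_gt0//.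
move=> c lam cc ll0 ll1; have cp : 0 < c by exact: lt_le_trans cc.
rewrite /rho -expr_div_n; set s := kappa / c.
have sp : 0 < s by rewrite divr_gt0.
have ss : s <= s0 by rewrite /s /s0 ler_pM2l// lef_pV2 ?posrE.
apply: ler_wsqrtr; rewrite ge_max !le_max; apply/andP; split; apply/orP; [left|right].
  have h1 : 1 - lam / (s + 1) <= a.
    rewrite le_max; apply/orP; left; rewrite lerD2l lerN2.
    apply: ler_pM; rewrite ?invr_ge0 ?(ltW l00) ?(ltW s1)//.
    by rewrite lef_pV2 ?posrE ?addr_gt0// lerD2r.
  have h2 : - a <= 1 - lam / (s + 1).
    rewrite lerNl opprB le_max; apply/orP; right; rewrite lerD2r.
    apply: le_trans ll1; rewrite ler_pdivrMr ?addr_gt0// ler_peMr ?lerDr ?(ltW sp)//.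
    exact: le_trans (ltW l00) ll0.
  by rewrite -[leLHS]real_normK ?num_real// ler_sqr ?nnegrE// ler_norml h1 h2.
rewrite div1r lerD2l lerN2; apply: ler_pM.
- exact: ltW.
- by rewrite invr_ge0 ltW.
- by apply: ler_pM; lra.
- by rewrite lef_pV2 ?posrE ?addr_gt0 ?exprn_gt0// lerD2l ler_sqr ?nnegrE ?(ltW sp) ?(ltW s00).
Qed.

(** * Error terms, limits inferior and superior, geometric decay *)

(** The error is at most [eta * eps] times the sum of the distances of [x] and [x'] to [p];
    absorbing the second distance on the left produces the denominator. *)
Lemma inexact_step (R : realType) (H : normedModType R) (x x' y e p : H) (eta eps r : R) :
  x' = y + eta *: e -> 0 <= eta -> 0 <= eps ->
  eta * eps < 1 -> `|e| <= eps * `|x - x'| ->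
  `|y - p| <= r * `|x - p| ->
  `|x' - p| <= (r + eta * eps) / (1 - eta * eps) * `|x - p|.
Proof.
move=> xE eta0 eps0 t1 ele yp.
rewrite mulrAC ler_pdivlMr ?subr_gt0//.
have h1 : `|x' - p| <= `|y - p| + eta * `|e|.
  by rewrite xE addrAC (le_trans (ler_normD _ _))// normrZ ger0_norm.
have h2 := ler_wpM2l eta0 ele.
have h3 : `|x - x'| <= `|x - p| + `|x' - p| by rewrite (distrC x') ler_distD.
have := ler_wpM2l (mulr_ge0 eta0 eps0) h3; lra.
Qed.

Lemma limn_esup_lt_near (R : realType) (u : nat -> R) (b : R) :
  (limn_esup (fun k => (u k)%:E) < b%:E)%E ->
  exists2 a, a < b & \forall k \near \oo, u k <= a.
Proof.
move=> /ereal_inf_lt[_ [V FV <-]]; set S := ereal_sup _ => Sb.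
have uS k : V k -> ((u k)%:E <= S)%E by move=> Vk; apply: ereal_sup_ubound; exists k.
(* A real tail supremum serves as [a]; if it is [-oo], then [V] is empty and any [a < b] will do. *)
clearbody S; case: S Sb uS => [r|//|] Sb uS.
  by exists r => //; apply: filterS FV => k /uS; rewrite lee_fin.
by exists (b - 1); [rewrite ltrBlDr ltrDl | apply: filterS FV => k /uS].
Qed.

Lemma limn_einf_gt_near (R : realType) (u : nat -> R) (b : R) :
  (b%:E < limn_einf (fun k => (u k)%:E))%E ->
  exists2 a, b < a & \forall k \near \oo, a <= u k.
Proof.
rewrite /limn_einf lteNr => /(@limn_esup_lt_near _ (fun k => - u k) (- b))[a ab ua].
by exists (- a); [rewrite ltrNr | apply: filterS ua => k; rewrite lerNl].
Qed.

(* [K] is chosen where [D k / mu ^+ k], which tends to [0], attains its maximum. *)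
Lemma geometric_from_maximum (R : realType) (D : nat -> R) (mu1 mu C : R) (N : nat) :
  0 <= mu1 < mu -> (forall k, 0 <= D k) ->
  (forall k, (N <= k)%N -> D k <= C * mu1 ^+ (k - N)) ->
  exists2 K, (N <= K)%N & forall k, (K <= k)%N -> D k <= mu ^+ (k - K) * D K.
Proof.
move=> /andP[mu10 mu1mu] D0 Dle; have mu0 : 0 < mu by exact: le_lt_trans mu1mu.
have [[k0 Nk0 Dk0]|D00] := pselect (exists2 k, (N <= k)%N & 0 < D k); last first.
  exists N => // k Nk; rewrite (_ : D k = 0) ?mulr_ge0 ?exprn_ge0 ?(ltW mu0)//.
  apply/eqP; rewrite eq_le D0 andbT leNgt; apply/negP => Dk.
  by apply: D00; exists k.
pose v k := D k / mu ^+ k.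
have v0 : 0 < v k0 by rewrite divr_gt0// exprn_gt0.
have vle k : (N <= k)%N -> v k <= C / mu ^+ N * (mu1 / mu) ^+ (k - N).
  move=> Nk; rewrite /v ler_pdivrMr ?exprn_gt0// (le_trans (Dle k Nk))//.
  rewrite expr_div_n -[in mu ^+ k](subnK Nk) exprD.
  have pos n : mu ^+ n != 0 by rewrite expf_neq0// gt_eqF.
  move: (mu ^+ _) (mu ^+ N) (mu1 ^+ _) (pos (k - N)%N) (pos N) => p q r p0 q0.
  suff -> : C / q * (r / p) * (p * q) = C * r by [].
  by field; rewrite p0.
have : (fun k => C / mu ^+ N * (mu1 / mu) ^+ k) @ \oo --> (0 : R).
  rewrite -[X in _ --> X](mulr0 (C / mu ^+ N)); apply: cvgM; first exact: cvg_cst.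
  by apply: cvg_expr; rewrite ger0_norm ?divr_ge0 ?(ltW mu0)// ltr_pdivrMr// mul1r.
move=> /cvgr_lt/(_ _ v0)[n1 _ vn1].
(* Past this finite range [v] stays below [v k0], so a maximum over the range is a maximum over all
   [k >= N]. *)
have k0lt : (k0 < (k0 + N + n1).+1)%N by rewrite ltnS -addnA leq_addr.
case: (@Order.TotalTheory.arg_maxP _ _ _ (Ordinal k0lt)
  (fun i : 'I_(k0 + N + n1).+1 => (N <= i)%N) (fun i => v i) Nk0) => K NK Kmax.
exists K => // k Kk; have Nk := leq_trans NK Kk.
suff : v k <= v K.
  rewrite /v ler_pdivrMr ?exprn_gt0// -[in mu ^+ k](subnK Kk) exprD.
  rewrite (_ : D K / _ * _ = mu ^+ (k - K) * D K) //.
  by rewrite mulrCA divfK// expf_neq0// gt_eqF.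
have [kl|kg] := ltnP k (k0 + N + n1).+1; first exact: (Kmax (Ordinal kl) Nk).
apply: (le_trans (vle k Nk)); apply: le_trans (Kmax (Ordinal k0lt) Nk0).
by apply/ltW/vn1 => /=; lia.
Qed.

(** * One step of the proximal point iteration *)

Section ProximalPoint.
Context {R : realType} {H : completeNormedModType R} {ip : {dot H for idfun}}.
Context (ipH : induces_norm ip) {A : H -> set H} (maxA : maximally_monotone ip A).
Context (zerA : zer A !=set0) {kappa delta : R} {xbar : H}.
Context (subreg : metrically_subregular A xbar 0 kappa delta).

Let P := projector (zer A).

Lemma zer_projector z : zer A (P z).
Proof.
exact: (projectorP _ _ _ ipH _ z zerA (closed_zer ipH maxA) (@midpoint_zer _ _ _ _ maxA)).1.
Qed.

Lemma dist_projector z : `|z - P z|%:E = edistance z (zer A).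
Proof.
exact: (projectorP _ _ _ ipH _ z zerA (closed_zer ipH maxA) (@midpoint_zer _ _ _ _ maxA)).2.
Qed.

Lemma dist_projector_le z p : zer A p -> `|z - P z| <= `|z - p|.
Proof. exact: projector_le (dist_projector z). Qed.

Section Step.
Context {c lam : R} {x : H}.
Let J := resolvent c A x.
Let y := (1 - lam) *: x + lam *: J.
Context (c0 : 0 < c) (lam_itv : 0 < lam < 2) (Jxbar : `|xbar - J| <= delta).

Let AJ : A J (c^-1 *: (x - J)).
Proof. exact: (resolventP _ _ _ ipH _ maxA). Qed.

Let ipJ_ge0 p : zer A p -> 0 <= ip (J - p) (x - J).
Proof.
move=> Zp; have [monA _] := maxA; have := monA _ _ _ _ AJ Zp.
by rewrite subr0 ipZr pmulr_rge0// invr_gt0.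
Qed.

Let split_x p : x - p = (J - p) + (x - J).
Proof. by rewrite [RHS]addrC addrA subrK. Qed.

Let split_y p : y - p = (J - p) + (1 - lam) *: (x - J).
Proof.
have E : lam *: J = J - (1 - lam) *: J by rewrite scalerBl scale1r opprB subrKC.
by rewrite /y E scalerBr addrCA addrAC.
Qed.

(** [J] lies in the ball of subregularity, and the element [c^-1 *: (x - J)] of [A J] bounds the
    distance from [0] to [A J]. *)
Lemma resolvent_dist_le : `|J - P J| <= kappa / c * `|x - J|.
Proof.
have [_ k0 d0 sub] := subreg.
rewrite -lee_fin dist_projector; apply: le_trans (sub J _) _.
  by rewrite closed_ballE.
have -> : kappa / c * `|x - J| = kappa * `|0 - c^-1 *: (x - J)|.
  by rewrite sub0r normrN normrZ gtr0_norm ?invr_gt0// mulrA.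
rewrite [leRHS]EFinM lee_pmul2l//.
by apply: ge_ereal_inf; exists (`|0 - c^-1 *: (x - J)|%:E) => //; exists (c^-1 *: (x - J)).
Qed.

Lemma relaxed_resolvent_contraction :
  `|y - P J| <= rho kappa c lam * `|x - P J|.
Proof.
have [_ k0 _ _] := subreg.
rewrite split_y (split_x (P J)); apply: (relaxation_contraction ipH) => //.
  exact/ipJ_ge0/zer_projector.
exact: resolvent_dist_le.
Qed.

Lemma dist_le_resolvent_step : `|x - P x| <= (kappa / c + 1) * `|x - J|.
Proof.
apply: le_trans (dist_projector_le x _ (zer_projector J)) _.
rewrite (split_x (P J)) (le_trans (ler_normD _ _))// mulrDl mul1r lerD2r.
exact: resolvent_dist_le.
Qed.

(** As [ip (J - P x) (x - J)] is nonnegative, both vectors are at most as long as their sum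
    [x - P x]; moreover [P J] is no farther from [J] than [P x] is. *)
Lemma dist_projector_resolvent_le : `|x - P J| <= 2 * `|x - P x|.
Proof.
have := ipJ_ge0 _ (zer_projector x); set a := J - P x; set b := x - J => ab0.
have E : `|x - P x| ^+ 2 = `|a| ^+ 2 + 2 * ip a b + `|b| ^+ 2.
  by rewrite split_x (normD_sqr ipH).
have ha : `|a| <= `|x - P x|.
  by rewrite -[_ <= _]ler_sqr ?nnegrE// E; have := sqr_ge0 `|b|; lra.
have hb : `|b| <= `|x - P x|.
  by rewrite -[_ <= _]ler_sqr ?nnegrE// E; have := sqr_ge0 `|a|; lra.
rewrite (split_x (P J)) (le_trans (ler_normD _ _))//.
by have := dist_projector_le J _ (zer_projector x); rewrite -/a -/b; lra.
Qed.

(** Subregularity bounds [J - P J], not [J - P x], so [rho] does not appear. The decrease comes from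
    [relaxation_le], the step [x - J] being bounded below by the distance of [x] to [zer A]. *)
Lemma relaxed_resolvent_dist_contraction :
  `|y - P x| <= Num.sqrt (1 - lam * (2 - lam) / (kappa / c + 1) ^+ 2) * `|x - P x|.
Proof.
have [_ k0 _ _] := subreg; have /andP[l0 l2] := lam_itv.
have s0 : 0 < kappa / c + 1 by rewrite addr_gt0// divr_gt0.
have h := relaxation_le ipH _ _ _ l0 (ipJ_ge0 _ (zer_projector x)).
rewrite -split_x -split_y in h.
set w := lam * (2 - lam) / _.
have w0 : 0 <= w by rewrite divr_ge0 ?exprn_ge0 ?(ltW s0)// mulr_ge0 ?subr_ge0// ltW.
have w1 : w <= 1.
  rewrite ler_pdivrMr ?exprn_gt0// mul1r.
  have : 1 <= (kappa / c + 1) ^+ 2 by rewrite expr_ge1 ?(ltW s0)// lerDr ltW// divr_gt0.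
  by have := sqr_ge0 (lam - 1); lra.
suff : `|y - P x| ^+ 2 <= (1 - w) * `|x - P x| ^+ 2.
  rewrite -[in leRHS](@sqr_sqrtr _ (1 - w)) ?subr_ge0// -exprMn.
  by rewrite ler_sqr ?nnegrE ?mulr_ge0 ?sqrtr_ge0.
apply: le_trans h _; rewrite mulrBl mul1r lerD2l lerN2.
have -> : w * `|x - P x| ^+ 2
    = lam * (2 - lam) * (`|x - P x| ^+ 2 / (kappa / c + 1) ^+ 2) by rewrite /w; ring.
rewrite ler_wpM2l ?mulr_ge0 ?subr_ge0 ?(ltW l0) ?(ltW l2)//.
rewrite ler_pdivrMr ?exprn_gt0// -exprMn mulrC ler_sqr ?nnegrE ?mulr_ge0 ?(ltW s0)//.
exact: dist_le_resolvent_step.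
Qed.

End Step.
End ProximalPoint.

(** * Linear convergence along the sequence *)

Theorem theorem5p6 (R : realType) (H : completeNormedModType R)
    (ip : {dot H for idfun}) (ipH : induces_norm ip)
    (A : H -> set H) (maxA : maximally_monotone ip A)
    (zerA : zer A !=set0)
    (x e : nat -> H) (lambda eta c eps : nat -> R)
    (lambda_itv : forall k, 0 < lambda k < 2)
    (eta_ge0 : forall k, 0 <= eta k)
    (c_gt0 : forall k, 0 < c k)
    (xS : forall k, x k.+1 = (1 - lambda k) *: x k
                             + lambda k *: resolvent (c k) A (x k)
                             + eta k *: e k)
    (xbar : H) (xbar_zer : zer A xbar)
    (kappa delta : R)
    (subreg : metrically_subregular A xbar 0 kappa delta)
    (eps_ge0 : forall k, 0 <= eps k)
    (eta_eps : (fun k => eta k * eps k) @ \oo --> (0 : R))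
    (e_le : forall k, `|e k| <= eps k * `|x k - x k.+1|)
    (J_cvg : (fun k => resolvent (c k) A (x k)) @ \oo --> xbar)
    (liminf_c : (0 < limn_einf (fun k => (c k)%:E))%E)
    (liminf_lambda : (0 < limn_einf (fun k => (lambda k)%:E))%E)
    (liminf_limsup_lambda : (limn_einf (fun k => (lambda k)%:E)
                             <= limn_esup (fun k => (lambda k)%:E))%E)
    (limsup_lambda : (limn_esup (fun k => (lambda k)%:E) < 2%:E)%E) :
  let rho_ k := rho kappa (c k) (lambda k) in
  let q k := projector (zer A) (resolvent (c k) A (x k)) in
  ((\forall k \near \oo,
      0 < rho_ k < 1 /\
      `|x k.+1 - q k|
        <= (rho_ k + eta k * eps k) / (1 - eta k * eps k) * `|x k - q k|) /\
   (exists (mu : R) (K : nat), 0 <= mu < 1 /\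
      forall k, (K <= k)%N ->
        `|x k.+1 - q k| <= mu * `|x k - q k| /\
        mu * `|x k - q k| <= mu ^+ (k - K + 1)%N * `|x K - q K|)) /\
  (zer A = [set xbar] ->
   (\forall k \near \oo,
      `|x k.+1 - xbar|
        <= (rho_ k + eta k * eps k) / (1 - eta k * eps k) * `|x k - xbar|) /\
   (exists (mu : R) (K : nat), 0 <= mu < 1 /\
      forall k, (K <= k)%N ->
        `|x k.+1 - xbar| <= mu * `|x k - xbar| /\
        mu * `|x k - xbar| <= mu ^+ (k - K + 1)%N * `|x K - xbar|)).
Proof.
move=> rho_ q; have [_ k0 d0 _] := subreg.
have [c0 c00 c0c] := limn_einf_gt_near _ _ _ liminf_c.
have [l0 l00 l0l] := limn_einf_gt_near _ _ _ liminf_lambda.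
have [l1 l12 ll1] := limn_esup_lt_near _ _ _ limsup_lambda.
have [r0 r01 rhor0] := rho_uniform_lt1 _ _ _ _ _ k0 c00 l00 l12.
(* Uniform bound on the factor by which the exact step shrinks the distance to [zer A]. *)
pose r1 := Num.sqrt (1 - l0 * (2 - l1) / (kappa / c0 + 1) ^+ 2).
have r11 : r1 < 1.
  rewrite -sqrtr1 ltr_sqrt// ltrBlDr ltrDl divr_gt0//.
    by rewrite mulr_gt0// subr_gt0.
  by rewrite exprn_gt0// addr_gt0// divr_gt0.
pose r := Num.max r0 r1.
have r0r : r0 <= r by rewrite le_max lexx.
have r1r : r1 <= r by rewrite le_max lexx orbT.
have rlt1 : r < 1 by rewrite gt_max r01.
have rge0 : 0 <= r by apply: le_trans r1r; exact: sqrtr_ge0.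
have [N _ evN] : \forall k \near \oo, [/\ c0 <= c k, l0 <= lambda k <= l1,
    `|xbar - resolvent (c k) A (x k)| <= delta & eta k * eps k <= (1 - r) / 4].
  have r4 : 0 < (1 - r) / 4 by rewrite divr_gt0 ?subr_gt0.
  near=> k; split; near: k => //.
  - by near=> k; apply/andP; split; near: k.
  - exact: (cvgr_dist_le _ _ J_cvg).
  - exact: (cvgr_le _ eta_eps _ r4).
pose D k := `|x k - q k|; pose d k := `|x k - projector (zer A) (x k)|.
pose mu1 := (1 + r) / 2; pose mu := (1 + mu1) / 2.
have mu1E : 0 <= mu1 < mu by rewrite /mu /mu1; lra.
have mulE : 0 <= mu < 1 by rewrite /mu /mu1; lra.
have step k : (N <= k)%N -> [/\ 0 < rho_ k < 1,
    `|x k.+1 - q k| <= (rho_ k + eta k * eps k) / (1 - eta k * eps k) * D k,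
    `|x k.+1 - q k| <= mu1 * D k, d k.+1 <= mu1 * d k & D k <= 2 * d k].
  move=> /evN[c0k /andP[l0k l1k] Jk tk].
  have rhor : rho_ k <= r by exact: le_trans (rhor0 _ _ c0k l0k l1k) r0r.
  have t0 : 0 <= eta k * eps k by rewrite mulr_ge0.
  have t1 : eta k * eps k < 1 by lra.
  (* The threshold [(1 - r) / 4] on [eta k * eps k] is chosen for this bound, [mu1] being halfway
     between [r] and [1]. *)
  have rate s : s <= r -> (s + eta k * eps k) / (1 - eta k * eps k) <= mu1.
    move=> sr; rewrite ler_pdivrMr ?subr_gt0// /mu1.
    have := mulr_ge0 t0 (_ : 0 <= 1 - r); rewrite subr_ge0 (ltW rlt1) => /(_ isT); lra.
  have h := inexact_step _ _ _ _ _ _ _ _ _ _ (xS k) (eta_ge0 k) (eps_ge0 k) t1 (e_le k).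
  have hq := h _ _ (relaxed_resolvent_contraction ipH maxA zerA subreg
                      (c_gt0 k) (lambda_itv k) Jk).
  have hp := h _ _ (relaxed_resolvent_dist_contraction ipH maxA zerA subreg
                      (c_gt0 k) (lambda_itv k) Jk).
  split=> //.
  - by rewrite rho_gt0//= (le_lt_trans rhor).
  - by apply: le_trans hq _; rewrite ler_wpM2r// rate.
  (* The projection of [x k] competes with that of [x k.+1]. *)
  - apply: le_trans (dist_projector_le ipH maxA zerA _ _ (zer_projector ipH maxA zerA (x k))) _.
    apply: le_trans hp _; rewrite ler_wpM2r// rate//; apply: le_trans r1r.
    apply: ler_wsqrtr; rewrite lerD2l lerN2; apply: ler_pM.
    + by apply: mulr_ge0; lra.
    + by rewrite invr_ge0 exprn_ge0// addr_ge0 ?divr_ge0 ?ltW.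
    + by apply: ler_pM; lra.
    + rewrite lef_pV2 ?posrE ?exprn_gt0 ?addr_gt0 ?divr_gt0//.
      rewrite ler_sqr ?nnegrE ?addr_ge0 ?divr_ge0 ?(ltW k0) ?(ltW c00) ?(ltW (c_gt0 k))//.
      by rewrite lerD2r ler_pM2l// lef_pV2 ?posrE.
  - exact: (dist_projector_resolvent_le ipH maxA zerA (c_gt0 k)).
have dle k : d (N + k)%N <= mu1 ^+ k * d N.
  elim: k => [|k IH]; first by rewrite addn0 expr0 mul1r.
  have [_ _ _ + _] := step (N + k)%N (leq_addr _ _); rewrite addnS => /le_trans; apply.
  by rewrite exprS -mulrA ler_wpM2l//; case/andP: mu1E.
have Dle k : (N <= k)%N -> D k <= (2 * d N) * mu1 ^+ (k - N).
  move=> Nk; have [_ _ _ _ /le_trans] := step k Nk; apply.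
  by rewrite -mulrA ler_wpM2l// mulrC -{1}(subnKC Nk).
have [K NK geo] := geometric_from_maximum _ _ _ _ _ _ mu1E (fun k => normr_ge0 (x k - q k)) Dle.
have partI : (\forall k \near \oo, 0 < rho_ k < 1 /\
      `|x k.+1 - q k|
        <= (rho_ k + eta k * eps k) / (1 - eta k * eps k) * `|x k - q k|) /\
   (exists (mu : R) (K : nat), 0 <= mu < 1 /\
      forall k, (K <= k)%N ->
        `|x k.+1 - q k| <= mu * `|x k - q k| /\
        mu * `|x k - q k| <= mu ^+ (k - K + 1)%N * `|x K - q K|).
  split; first by exists N => // k /= /step[].
  (* The exponent [k - K + 1] is the [k - K] of [geo] plus the factor [mu] in front. *)
  exists mu, K; split=> // k Kk; have [_ _ hk _ _] := step k (leq_trans NK Kk).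
  have /andP[mu10 /ltW mu1mu] := mu1E; have mu0 := le_trans mu10 mu1mu.
  split; first by rewrite (le_trans hk)// ler_wpM2r // normr_ge0.
  by rewrite addn1 exprS -mulrA ler_wpM2l// geo.
split=> // zer1.
(* With a single zero every projection is [xbar], so the second part is an instance of the first. *)
have qE k : q k = xbar.
  by have := zer_projector ipH maxA zerA (resolvent (c k) A (x k)); rewrite {1}zer1.
have [evI [mu' [K' [mu'1 geo']]]] := partI; split.
  by apply: filterS evI => k [_]; rewrite qE.
by exists mu', K'; split=> // k /geo'; rewrite !qE.
Unshelve. all: by end_near. Qed.
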